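(* Let $d\ge2$, $L\ge1$, and let $\{|\psi_1^{(\alpha)}\rangle,\dots,|\psi_d^{(\alpha)}\rangle\}$, $\alpha=1,\dots,L$, be $L$ mutually unbiased bases of $\mathbb{C}^d$. Let $P_k^{(\alpha)}=|\psi_k^{(\alpha)}\rangle\langle\psi_k^{(\alpha)}|$, and for each $\alpha$ let $\mathcal{O}^{(\alpha)}=(\mathcal{O}^{(\alpha)}_{kl})$ be an orthogonal rotation in $\mathbb{R}^d$ around the axis $\vec{n}=\frac{1}{\sqrt d}(1,1,\dots,1)$, that is, $\mathcal{O}^{(\alpha)}\vec n=\vec n$. Define $$W_L=\frac{d-1+L}{d}\,I_d\otimes I_d-\sum_{\alpha=1}^{L}\sum_{k,l=1}^{d}\mathcal{O}^{(\alpha)}_{kl}\,\overline{P_l^{(\alpha)}}\otimes P_k^{(\alpha)}.$$ Then for every state $\rho$ on $\mathbb{C}^d\otimes\mathbb{C}^d$, $$D_{sep}(\rho)\ge-\frac{1}{\sqrt{L(d-1)}}\operatorname{Tr}(W_L\rho).$$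
   Context: Orthonormal bases $\{|\psi_k\rangle\}_{k=1}^d$ and $\{|\phi_l\rangle\}_{l=1}^d$ of $\mathbb{C}^d$ are mutually unbiased if $|\langle\psi_k|\phi_l\rangle|^2=\frac1d$ for all $k,l$; a family of bases is mutually unbiased if its members are pairwise so. $\overline{P}$ denotes the entrywise complex conjugate of $P$ in the standard basis. A state is a positive semidefinite operator of trace one. A state $\sigma$ on $\mathbb{C}^d\otimes\mathbb{C}^d$ is separable if $\sigma=\sum_i p_i\,\rho_A^i\otimes\rho_B^i$ for a (finite) probability distribution $\{p_i\}$ and states $\rho_A^i,\rho_B^i$ on $\mathbb{C}^d$; $Sep(A:B)$ is the set of separable states. $\|A\|_F=\sqrt{\operatorname{Tr}(A^\dagger A)}$ is the Frobenius norm, and $D_{sep}(\rho)=\min_{\sigma\in Sep(A:B)}\|\rho-\sigma\|_F$. *)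

(* Defs.v *)
From mathcomp Require Import all_boot all_order all_algebra.
From mathcomp Require Import all_classical all_reals.
From mathcomp Require Import complex mxtens.

Set Implicit Arguments.
Unset Strict Implicit.
Unset Printing Implicit Defensive.

Import Order.TTheory GRing.Theory Num.Theory.

Local Open Scope ring_scope.
Local Open Scope sesquilinear_scope.
Local Open Scope complex_scope.

Section Defs.
Variable R : realType.
Local Notation C := R[i].

(* Linear in the second argument, as for bras and kets. *)
Definition braket (d : nat) (u v : 'cV[C]_d) : C := (u^t* *m v) 0 0.

Definition rank1proj (d : nat) (u : 'cV[C]_d) : 'M[C]_d := u *m u^t*.

(* An orthonormal family of d vectors of C^d is automatically a basis. *)
Definition orthonormal_basis (d : nat) (psi : 'I_d -> 'cV[C]_d) : Prop :=
  forall k l, braket (psi k) (psi l) = (k == l)%:R.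

Definition unbiased (d : nat) (psi phi : 'I_d -> 'cV[C]_d) : Prop :=
  forall k l, `|braket (psi k) (phi l)| ^+ 2 = d%:R^-1.

Definition mutually_unbiased_bases (d L : nat)
    (psi : 'I_L -> 'I_d -> 'cV[C]_d) : Prop :=
  (forall a, orthonormal_basis (psi a)) /\
  (forall a b, a != b -> unbiased (psi a) (psi b)).

Definition diag_axis (d : nat) : 'cV[R]_d := const_mx (Num.sqrt d%:R)^-1.

(* The determinant is not required to be 1: only orthogonality and the fixed
   axis are. *)
Definition axis_rotation (d : nat) (O : 'M[R]_d) : Prop :=
  O^T *m O = 1%:M /\ O *m diag_axis d = diag_axis d.

(* In the order of C, 0 <= z means that z is real and nonnegative. *)
Definition psdmx (n : nat) (A : 'M[C]_n) : Prop :=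
  A^t* = A /\ forall v : 'cV[C]_n, 0 <= braket v (A *m v).

Definition state (n : nat) (rho : 'M[C]_n) : Prop :=
  psdmx rho /\ \tr rho = 1.

(* C^d (x) C^d is identified with C^(d * d) through the Kronecker product *t;
   the first factor is subsystem A. *)
Definition separable (d : nat) (sigma : 'M[C]_(d * d)) : Prop :=
  exists (n : nat) (p : 'I_n -> R) (rhoA rhoB : 'I_n -> 'M[C]_d),
    [/\ forall i, 0 <= p i,
        \sum_i p i = 1,
        forall i, state (rhoA i) /\ state (rhoB i) &
        sigma = \sum_i (p i)%:C *: (rhoA i *t rhoB i)].

(* \tr (A^t* *m A) is real and nonnegative, so taking Re loses nothing. *)
Definition frobenius_norm (n : nat) (A : 'M[C]_n) : R :=
  Num.sqrt (complex.Re (\tr (A^t* *m A))).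

(* The infimum is attained, as the separable states form a compact set. *)
Definition Dsep (d : nat) (rho : 'M[C]_(d * d)) : R :=
  inf [set frobenius_norm (rho - sigma) | sigma in @separable d].

Definition mub_witness (d L : nat) (psi : 'I_L -> 'I_d -> 'cV[C]_d)
    (O : 'I_L -> 'M[R]_d) : 'M[C]_(d * d) :=
  ((d%:R - 1 + L%:R) / d%:R) *: (1%:M *t 1%:M)
  - \sum_(a < L) \sum_(k < d) \sum_(l < d)
      (O a k l)%:C *:
        (map_mx Num.conj (rank1proj (psi a l)) *t rank1proj (psi a k)).

End Defs.

(* Main.v *)
(** Write [W_L = c I - B], where [c = (d - 1 + L) / d].  On a product state
[A (x) B'], orthogonality of the rotations and [2 x y <= x^2 + y^2] bound
[Tr (B (A (x) B'))] by the mean of the sums of squared outcome probabilities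
of [A] and [B'] in the [L] bases.  Each sum is at most [c], by Bessel's
inequality for the projectors of the mutually unbiased bases and
[Tr (A^2) <= 1].  Hence [Tr (W_L sigma) >= 0] for separable [sigma], and
[- Tr (W_L rho) <= Tr (B (rho - sigma))].  As [rho - sigma] has trace zero,
[B] can be replaced here by the traceless [B - (L / d) I], whose squared
Frobenius norm is [L (d - 1)]; conclude by the Cauchy-Schwarz inequality. *)

Require Import Defs.
From mathcomp Require Import all_boot all_order all_algebra.
From mathcomp Require Import all_classical all_reals.
From mathcomp Require Import complex mxtens.
From mathcomp Require Import ring.

Set Implicit Arguments.
Unset Strict Implicit.
Unset Printing Implicit Defensive.

Import Order.TTheory GRing.Theory Num.Theory.
Local Open Scope ring_scope.
Local Open Scope sesquilinear_scope.

(** * Traces of products of Hermitian matrices *)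

Section HilbertSchmidt.
Context {C : numClosedFieldType}.

Lemma adjmxM m n p (A : 'M[C]_(m, n)) (B : 'M_(n, p)) :
  (A *m B)^t* = B^t* *m A^t*.
Proof. by rewrite trmx_mul map_mxM. Qed.

Lemma adjmxB m n (A B : 'M[C]_(m, n)) : (A - B)^t* = A^t* - B^t*.
Proof. by rewrite !raddfB. Qed.

Lemma adjmxZ m n (a : C) (A : 'M[C]_(m, n)) : (a *: A)^t* = a^* *: A^t*.
Proof. by rewrite linearZ map_mxZ. Qed.

Lemma adjmx_sum m n (I : Type) (r : seq I) (F : I -> 'M[C]_(m, n)) :
  (\sum_(i <- r) F i)^t* = \sum_(i <- r) (F i)^t*.
Proof. by rewrite !raddf_sum. Qed.

Lemma adjmx_tens m n p q (A : 'M[C]_(m, n)) (B : 'M[C]_(p, q)) :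
  (A *t B)^t* = A^t* *t B^t*.
Proof. by rewrite trmx_tens map_mxT. Qed.

Lemma adjmx1 n : (1%:M : 'M[C]_n)^t* = 1%:M.
Proof. by rewrite trmx1 map_mx1. Qed.

Lemma mxtrace_adj n (A : 'M[C]_n) : \tr (A^t*) = (\tr A)^*.
Proof. by rewrite trace_map_mx mxtrace_tr. Qed.

Lemma mxtrace_tens m n (A : 'M[C]_m) (B : 'M[C]_n) :
  \tr (A *t B) = \tr A * \tr B.
Proof. by rewrite /mxtrace mulr_sum; apply: eq_bigr => i _; rewrite mxE. Qed.

Lemma mxtrace_herm_mul_real n (A B : 'M[C]_n) :
  A^t* = A -> B^t* = B -> \tr (A *m B) \is Num.real.
Proof.
by move=> hA hB; rewrite CrealE -mxtrace_adj adjmxM hA hB mxtrace_mulC.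
Qed.

Lemma mxtrace_adj_mul n (A : 'M[C]_n) :
  \tr (A^t* *m A) = \sum_i \sum_j `|A j i| ^+ 2.
Proof.
apply: eq_bigr => i _; rewrite mxE; apply: eq_bigr => j _.
by rewrite !mxE normCK mulrC.
Qed.

Lemma mxtrace_herm_sqr_ge0 n (A : 'M[C]_n) : A^t* = A -> 0 <= \tr (A *m A).
Proof.
move=> hA; rewrite -{1}hA mxtrace_adj_mul.
by do 2!apply: sumr_ge0 => ? _; rewrite exprn_ge0.
Qed.

Lemma mxtrace_herm_sqr_eq0 n (A : 'M[C]_n) :
  A^t* = A -> \tr (A *m A) = 0 -> A = 0.
Proof.
move=> hA; rewrite -{1}hA mxtrace_adj_mul => h0.
have ge0 i j : 0 <= `|A j i| ^+ 2 by rewrite exprn_ge0.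
apply/matrixP => j i; rewrite mxE.
have /(_ i isT) hi := psumr_eq0P (fun i _ => sumr_ge0 _ (fun j _ => ge0 i j)) h0.
have /(_ j isT) /eqP := psumr_eq0P (fun j _ => ge0 i j) hi.
by rewrite expf_eq0 /= normr_eq0 => /eqP.
Qed.

(** Expand [0 <= \tr (X *m X)] for [X = \tr (A *m A) *: B - \tr (A *m B) *: A], then cancel the
    positive factor [\tr (A *m A)]. *)
Lemma mxtrace_herm_CauchySchwarz n (A B : 'M[C]_n) :
  A^t* = A -> B^t* = B ->
  \tr (A *m B) ^+ 2 <= \tr (A *m A) * \tr (B *m B).
Proof.
move=> hA hB.
have [/(mxtrace_herm_sqr_eq0 hA) ->|a_neq0] := eqVneq (\tr (A *m A)) 0.
  by rewrite !mul0mx mxtrace0 mul0r expr0n.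
have a_gt0 : 0 < \tr (A *m A) by rewrite lt0r a_neq0 mxtrace_herm_sqr_ge0.
have ar : (\tr (A *m A))^* = \tr (A *m A).
  exact/conj_Creal/mxtrace_herm_mul_real.
have tr : (\tr (A *m B))^* = \tr (A *m B).
  exact/conj_Creal/mxtrace_herm_mul_real.
set a := \tr (A *m A) in a_gt0 ar *; set t := \tr (A *m B) in tr *.
set X := a *: B - t *: A.
have hX : X^t* = X by rewrite adjmxB !adjmxZ hA hB; congr (_ *: _ - _ *: _).
have := mxtrace_herm_sqr_ge0 hX.
have -> : \tr (X *m X) = a * (a * \tr (B *m B) - t ^+ 2).
  rewrite /X mulmxBl !mulmxBr -!scalemxAl -!scalemxAr !linearB /= !linearZ /=.
  rewrite [\tr (B *m A)]mxtrace_mulC -/a -/t; ring.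
by rewrite pmulr_rge0 // subr_ge0.
Qed.

(** By the spectral theorem, this compares the sum of the squares of nonnegative eigenvalues with
    the square of their sum. *)
Lemma psd_mxtrace_sqr_le n (A : 'M[C]_n) : A^t* = A ->
  (forall v : 'cV_n, 0 <= (v^t* *m (A *m v)) 0 0) ->
  \tr (A *m A) <= \tr A ^+ 2.
Proof.
move=> hA psdA.
have /orthomx_spectralP defA : A \is normalmx by apply/normalmxP; rewrite hA.
set P := spectralmx A in defA *; set D := spectral_diag A in defA.
have uP : P \is unitarymx := spectral_unitarymx A.
have PPV : P *m P^t* = 1%:M by apply/unitarymxP.
rewrite invmx_unitary // in defA.
(* An eigenvalue is the value of the quadratic form at its unit eigenvector, column [i] of
   [P^t*]. *)
have D_ge0 i : 0 <= D 0 i.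
  have := psdA (col i (P^t*)); rewrite defA.
  have -> : (col i (P^t*))^t* = row i P.
    by apply/matrixP=> a b; rewrite !mxE conjCK.
  rewrite colE !mulmxA mulmxtVK // -row_mul PPV row1 -rowE -colE.
  by rewrite !mxE eqxx mulr1n.
have -> : \tr (A *m A) = \sum_i D 0 i ^+ 2.
  rewrite defA !mulmxA mulmxtVK // mxtrace_mulC !mulmxA PPV mul1mx.
  by rewrite mulmx_diag mxtrace_diag; apply: eq_bigr => i _; rewrite mxE.
have -> : \tr A = \sum_i D 0 i.
  by rewrite defA mxtrace_mulC !mulmxA PPV mul1mx mxtrace_diag.
rewrite [leRHS]expr2 mulr_suml; apply: ler_sum => i _.
rewrite expr2 ler_wpM2l // (bigD1 i) //= lerDl; exact: sumr_ge0.
Qed.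

End HilbertSchmidt.

(** * Projectors of mutually unbiased bases and Bessel's inequality *)

Section Projectors.
Context {C : numClosedFieldType}.

(** Only trace relations and completeness are recorded, so the conjugated projectors fit the same
    predicate. *)
Definition mub_projectors d L (P : 'I_L -> 'I_d -> 'M[C]_d) : Prop :=
  [/\ forall a k, (P a k)^t* = P a k,
      forall a k l, \tr (P a k *m P a l) = (k == l)%:R,
      forall a b k l, a != b -> \tr (P a k *m P b l) = d%:R^-1 &
      forall a, \sum_k P a k = 1%:M].

Lemma sum_const_neq L (a : 'I_L) (x : C) :
  \sum_(b < L | b != a) x = (L%:R - 1) * x.
Proof.
have := sumr_const 'I_L x; rewrite card_ord (bigD1 a) //= => h.
by apply: (addrI x); rewrite h -[in LHS]mulr_natl; ring.
Qed.

Lemma mub_mxtrace_proj d L (P : 'I_L -> 'I_d -> 'M[C]_d) a k :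
  mub_projectors P -> \tr (P a k) = 1.
Proof.
case=> _ P1 _ PI; rewrite -[P a k]mulmx1 -(PI a) mulmx_sumr raddf_sum /=.
rewrite (bigD1 k) //= P1 eqxx big1 ?addr0 // => l lk.
by rewrite P1 eq_sym (negbTE lk).
Qed.

(** Basis [a] contributes its own coefficient; each of the other [L - 1] bases contributes [1 / d],
    since its coefficients sum to 1. *)
Lemma mub_mxtrace_comb d L (P : 'I_L -> 'I_d -> 'M[C]_d) (c : 'I_L -> 'I_d -> C) :
  mub_projectors P -> (forall a, \sum_k c a k = 1) -> forall a k,
  \tr (P a k *m (\sum_b \sum_l c b l *: P b l)) = c a k + (L%:R - 1) / d%:R.
Proof.
case=> _ P1 P2 _ c1 a k; rewrite mulmx_sumr raddf_sum (bigD1 a) //=; congr (_ + _).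
  rewrite mulmx_sumr raddf_sum (bigD1 k) //= -scalemxAr mxtraceZ P1 eqxx mulr1.
  rewrite big1 ?addr0 // => l lk.
  by rewrite -scalemxAr mxtraceZ P1 eq_sym (negbTE lk) mulr0.
rewrite -(sum_const_neq a); apply: eq_bigr => b ba.
rewrite -[d%:R^-1]mul1r -[X in X * _](c1 b) mulr_suml mulmx_sumr raddf_sum /=.
by apply: eq_bigr => l _; rewrite -scalemxAr mxtraceZ P2 // eq_sym.
Qed.

(* Bessel: the projection of [rho] on the span of the [P a k] is
   [\sum (\tr (P a k rho)) P a k - (L - 1) / d]. *)
Lemma mub_sum_sqr_le d L (P : 'I_L -> 'I_d -> 'M[C]_d) (rho : 'M[C]_d) :
  (0 < d)%N -> mub_projectors P -> rho^t* = rho -> \tr rho = 1 ->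
  \sum_a \sum_k \tr (P a k *m rho) ^+ 2 <=
    \tr (rho *m rho) + (L%:R - 1) / d%:R.
Proof.
move=> d_gt0 hP hrho rho1; have [Ph _ _ PI] := hP.
pose c a k := \tr (P a k *m rho).
have c1 a : \sum_k c a k = 1.
  by rewrite /c -raddf_sum -mulmx_suml PI mul1mx.
have cr a k : (c a k)^* = c a k by apply/conj_Creal/mxtrace_herm_mul_real.
pose T := \sum_a \sum_k c a k *: P a k.
pose s : C := (L%:R - 1) / d%:R.
(* The residual of [rho] after projection: [\tr (X *m X)] is exactly the gap in the inequality. *)
pose X := rho - T - (- s) *: 1%:M.
have hT : T^t* = T.
  rewrite adjmx_sum; apply: eq_bigr => a _; rewrite adjmx_sum.
  by apply: eq_bigr => k _; rewrite adjmxZ Ph cr.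
have hX : X^t* = X.
  rewrite !adjmxB hrho hT adjmxZ adjmx1; congr (_ - _ *: _).
  by apply/conj_Creal; rewrite rpredN rpred_div ?rpredB ?rpred_nat ?rpred1.
set S := \sum_a _.
have trTr : \tr (T *m rho) = S.
  rewrite mulmx_suml raddf_sum; apply: eq_bigr => a _ /=.
  rewrite mulmx_suml raddf_sum; apply: eq_bigr => k _ /=.
  by rewrite -scalemxAl mxtraceZ expr2.
have trTT : \tr (T *m T) = S + L%:R * s.
  rewrite {1}/T mulmx_suml raddf_sum /=.
  under eq_bigr => a _.
    rewrite mulmx_suml raddf_sum /=.
    under eq_bigr => k _ do
      rewrite -scalemxAl mxtraceZ (mub_mxtrace_comb hP c1) mulrDr -expr2.
    rewrite big_split /= -mulr_suml c1 mul1r.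
    over.
  by rewrite big_split /= sumr_const card_ord mulr_natl.
have trT : \tr T = L%:R.
  rewrite raddf_sum /=; under eq_bigr => a _.
    rewrite raddf_sum /=; under eq_bigr => k _ do
      rewrite mxtraceZ (mub_mxtrace_proj _ _ hP) mulr1.
    rewrite c1; over.
  by rewrite sumr_const card_ord.
have := mxtrace_herm_sqr_ge0 hX.
have -> : \tr (X *m X) = \tr (rho *m rho) + s - S.
  rewrite /X !mulmxBl !mulmxBr -!scalemxAl -!scalemxAr !mul1mx !mulmx1.
  rewrite !linearB /= !linearZ /= mxtrace1 rho1 trT [\tr (rho *m T)]mxtrace_mulC.
  rewrite trTr trTT /s; field.
  by rewrite pnatr_eq0 -lt0n.
by rewrite subr_ge0.
Qed.

Lemma mub_projectors_conj d L (P : 'I_L -> 'I_d -> 'M[C]_d) :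
  mub_projectors P -> mub_projectors (fun a k => map_mx Num.conj (P a k)).
Proof.
case=> Ph P1 P2 PI; split.
- by move=> a k; rewrite -[in RHS]Ph map_trmx.
- by move=> a k l; rewrite -map_mxM trace_map_mx P1 rmorph_nat.
- move=> a b k l ab; rewrite -map_mxM trace_map_mx P2 //.
  by rewrite fmorphV rmorph_nat.
- by move=> a; rewrite -raddf_sum /= PI map_mx1.
Qed.

End Projectors.

Lemma tensmx11 (R : pzRingType) m n :
  (1%:M : 'M[R]_m) *t (1%:M : 'M[R]_n) = 1%:M.
Proof.
apply/matrixP => i j.
case: (mxtens_indexP i) => i1 i2; case: (mxtens_indexP j) => j1 j2.
rewrite tensmxE !mxE -natrM mulnb (inj_eq (can_inj (@mxtens_indexK m n))).
by rewrite xpair_eqE.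
Qed.

(** * The correlation operator of two families of projectors *)

Section Correlation.
Context {C : numClosedFieldType} {d L : nat} (O : 'I_L -> 'M[C]_d)
  (Q P : 'I_L -> 'I_d -> 'M[C]_d).
Hypothesis d_gt0 : (0 < d)%N.
Hypothesis O_real : forall a, O a \is a mxOver Num.real.
Hypothesis O_orth : forall a, (O a)^T *m O a = 1%:M.
Hypothesis O_row : forall a k, \sum_l O a k l = 1.
Hypotheses (hQ : mub_projectors Q) (hP : mub_projectors P).

(** The operator subtracted in [W_L], for two arbitrary families; the witness takes for [Q] the
    entrywise conjugate of [P]. *)
Definition mub_corr : 'M[C]_(d * d) :=
  \sum_a \sum_k \sum_l O a k l *: (Q a l *t P a k).

Lemma mub_corr_mulr_mxtrace (A : 'M_(d * d)) :
  \tr (mub_corr *m A) =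
    \sum_a \sum_k \sum_l O a k l * \tr ((Q a l *t P a k) *m A).
Proof.
do 3!(rewrite mulmx_suml raddf_sum; apply: eq_bigr => ? _ /=).
by rewrite -scalemxAl mxtraceZ.
Qed.

Lemma mub_corr_herm : mub_corr^t* = mub_corr.
Proof.
have [Qh _ _ _] := hQ; have [Ph _ _ _] := hP.
do 3!(rewrite adjmx_sum; apply: eq_bigr => ? _).
rewrite adjmxZ adjmx_tens Qh Ph; congr (_ *: _); apply/conj_Creal.
exact/mxOverP.
Qed.

Lemma sum_entries_rotation a : \sum_k \sum_l O a k l = d%:R.
Proof.
by under eq_bigr do rewrite O_row; rewrite sumr_const card_ord.
Qed.

(** The sum is the trace of [(O a)^T *m O a], the identity. *)
Lemma sum_sqr_entries_rotation a : \sum_k \sum_l O a k l ^+ 2 = d%:R.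
Proof.
rewrite -(mxtrace1 C d) -(O_orth a) exchange_big; apply: eq_bigr => l _ /=.
by rewrite mxE; apply: eq_bigr => k _; rewrite mxE expr2.
Qed.

Lemma mxtrace_mub_corr : \tr mub_corr = L%:R * d%:R.
Proof.
rewrite -[mub_corr]mulmx1 mub_corr_mulr_mxtrace.
under eq_bigr => a _.
  under eq_bigr => k _ do under eq_bigr => l _ do
    rewrite mulmx1 mxtrace_tens (mub_mxtrace_proj _ _ hQ)
      (mub_mxtrace_proj _ _ hP) !mulr1.
  rewrite sum_entries_rotation; over.
by rewrite sumr_const card_ord mulr_natl.
Qed.

(** Within basis [a] only the matching term survives. For [b != a] every product of traces is
    [1 / d ^ 2] and the entries of [O b] sum to [d], leaving [1 / d]. *)
Lemma mub_corr_mxtrace_term a k l :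
  \tr ((Q a l *t P a k) *m mub_corr) = O a k l + (L%:R - 1) / d%:R.
Proof.
have [_ Q1 Q2 _] := hQ; have [_ P1 P2 _] := hP.
rewrite mxtrace_mulC mub_corr_mulr_mxtrace (bigD1 a) //=; congr (_ + _).
  under eq_bigr => m _ do under eq_bigr => n _ do
    rewrite tensmx_mul mxtrace_tens Q1 P1.
  rewrite (bigD1 k) //= (bigD1 l) //= !eqxx !mulr1 !big1 ?addr0 //.
    move=> m /negbTE mk; rewrite big1 // => n _.
    by rewrite mk !mulr0.
  by move=> n /negbTE nl; rewrite nl mul0r mulr0.
rewrite -(sum_const_neq a); apply: eq_bigr => b ba.
under eq_bigr => m _ do under eq_bigr => n _ do
  rewrite tensmx_mul mxtrace_tens (Q2 _ _ _ _ ba) (P2 _ _ _ _ ba).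
under eq_bigr => m _ do rewrite -mulr_suml.
rewrite -mulr_suml sum_entries_rotation mulrA divff ?mul1r //.
by rewrite pnatr_eq0 -lt0n.
Qed.

Lemma mxtrace_mub_corr_sqr :
  \tr (mub_corr *m mub_corr) = L%:R * d%:R + L%:R * (L%:R - 1).
Proof.
rewrite mub_corr_mulr_mxtrace.
under eq_bigr => a _.
  under eq_bigr => k _.
    under eq_bigr => l _ do rewrite mub_corr_mxtrace_term mulrDr -expr2.
    rewrite big_split /= -mulr_suml; over.
  rewrite big_split /= sum_sqr_entries_rotation -mulr_suml.
  rewrite sum_entries_rotation mulrCA divff ?pnatr_eq0 -?lt0n // mulr1.
  over.
by rewrite sumr_const card_ord -mulrDr mulr_natl.
Qed.

(** The shift [L / d] is [\tr mub_corr / d ^ 2], the one that makes the trace vanish. *)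
Lemma mxtrace_traceless_mub_corr_sqr :
  let B := mub_corr - (L%:R / d%:R) *: 1%:M in
  \tr (B *m B) = L%:R * (d%:R - 1).
Proof.
rewrite /= !mulmxBl !mulmxBr -!scalemxAl -!scalemxAr !mul1mx !mulmx1.
rewrite !linearB /= !linearZ /= mxtrace1 mxtrace_mub_corr_sqr mxtrace_mub_corr.
rewrite natrM; field.
by rewrite pnatr_eq0 -lt0n.
Qed.

Lemma mub_corr_prod_le (A B : 'M[C]_d) :
  A^t* = A -> B^t* = B -> \tr A = 1 -> \tr B = 1 ->
  \tr (A *m A) <= 1 -> \tr (B *m B) <= 1 ->
  \tr (mub_corr *m (A *t B)) <= (d%:R - 1 + L%:R) / d%:R.
Proof.
move=> hA hB A1 B1 AA BB; have [Qh _ _ _] := hQ; have [Ph _ _ _] := hP.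
pose x a l := \tr (Q a l *m A); pose y a k := \tr (P a k *m B).
have xr a l : x a l \is Num.real by apply/mxtrace_herm_mul_real.
have yr a k : y a k \is Num.real by apply/mxtrace_herm_mul_real.
pose z a k := \sum_l O a k l * x a l.
have zr a k : z a k \is Num.real.
  by apply: rpred_sum => l _; rewrite rpredM //; exact/mxOverP.
(* [z a] is the rotated vector of outcome probabilities [x a], and rotation keeps its Euclidean
   length. *)
have zz a : \sum_k z a k ^+ 2 = \sum_l x a l ^+ 2.
  pose X : 'cV_d := \col_l x a l.
  have zE k : z a k = (O a *m X) k 0.
    by rewrite mxE; apply: eq_bigr => l _; rewrite mxE.
  transitivity (((O a *m X)^T *m (O a *m X)) 0 0).
    by rewrite mxE; apply: eq_bigr => k _; rewrite zE expr2 [in RHS]mxE.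
  rewrite trmx_mul -mulmxA [_ *m (_ *m X)]mulmxA O_orth mul1mx mxE.
  by apply: eq_bigr => l _; rewrite !mxE expr2.
have Sx := mub_sum_sqr_le d_gt0 hQ hA A1.
have Sy := mub_sum_sqr_le d_gt0 hP hB B1.
have -> : \tr (mub_corr *m (A *t B)) = \sum_a \sum_k z a k * y a k.
  rewrite mub_corr_mulr_mxtrace; apply: eq_bigr => a _; apply: eq_bigr => k _.
  rewrite mulr_suml; apply: eq_bigr => l _.
  by rewrite tensmx_mul mxtrace_tens mulrA.
apply: (@le_trans _ _
  ((\sum_a \sum_l x a l ^+ 2 + \sum_a \sum_k y a k ^+ 2) / 2)).
  rewrite ler_pdivlMr ?ltr0n // -big_split /= mulr_suml.
  apply: ler_sum => a _; rewrite -zz -big_split /= mulr_suml.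
  apply: ler_sum => k _; rewrite -subr_ge0.
  have -> : z a k ^+ 2 + y a k ^+ 2 - z a k * y a k * 2 = (z a k - y a k) ^+ 2.
    by ring.
  by apply: real_exprn_even_ge0; rewrite ?rpredB.
rewrite ler_pdivrMr ?ltr0n //.
(* Each summand is the Bessel bound with [\tr (A *m A)] or [\tr (B *m B)] replaced by 1. *)
have -> : (d%:R - 1 + L%:R) / d%:R * 2 =
   (1 + (L%:R - 1) / d%:R) + (1 + (L%:R - 1) / d%:R) :> C.
  by field; rewrite pnatr_eq0 -lt0n.
by apply: lerD; [apply: le_trans Sx _|apply: le_trans Sy _]; rewrite lerD2r.
Qed.

End Correlation.


(** * States, separability and the bound against one separable state *)

Section States.
Context {R : realType}.
Local Open Scope complex_scope.
Local Notation C := R[i].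

Lemma braketE d (u v : 'cV[C]_d) : u^t* *m v = (braket u v)%:M.
Proof. exact: mx11_scalar. Qed.

Lemma braket_conj d (u v : 'cV[C]_d) : braket v u = Num.conj (braket u v).
Proof.
rewrite /braket; have -> : v^t* *m u = (u^t* *m v)^t* by rewrite adjmxM trmxCK.
by rewrite !mxE.
Qed.

Lemma mxtrace_rank1proj d (u v : 'cV[C]_d) :
  \tr (rank1proj u *m rank1proj v) = `|braket u v| ^+ 2.
Proof.
rewrite /rank1proj mulmxA mxtrace_mulC !mulmxA -mulmxA !braketE.
by rewrite -scalar_mxM mxtrace_scalar mulr1n normCK mulrC -braket_conj.
Qed.

Lemma mub_projectors_rank1 d L (psi : 'I_L -> 'I_d -> 'cV[C]_d) :
  mutually_unbiased_bases psi ->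
  mub_projectors (fun a k => rank1proj (psi a k)).
Proof.
case=> on mu; split=> [a k|a k l|a b k l ab|a].
- by rewrite /rank1proj adjmxM trmxCK.
- by rewrite mxtrace_rank1proj on normr_nat; case: (k == l); rewrite ?expr1n ?expr0n.
- by rewrite mxtrace_rank1proj mu.
pose U : 'M[C]_d := \matrix_(i, k) psi a k i 0.
(* Orthonormality says that the square matrix [U] has left inverse [U^t*]; this is then also a right
   inverse, which is completeness. *)
have /mulmx1C UU : U^t* *m U = 1%:M.
  apply/matrixP => k l; rewrite [RHS]mxE -(on a) /braket !mxE.
  by apply: eq_bigr => i _; rewrite !mxE.
rewrite -UU; apply/matrixP => i j; rewrite summxE mxE; apply: eq_bigr => k _.
by rewrite !mxE big_ord1 !mxE.
Qed.

Lemma separable_herm d (sigma : 'M[C]_(d * d)) :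
  separable sigma -> sigma^t* = sigma.
Proof.
case=> n [p [A [B [_ _ AB ->]]]]; rewrite adjmx_sum; apply: eq_bigr => i _.
have [[[hA _] _] [[hB _] _]] := AB i.
by rewrite adjmxZ adjmx_tens hA hB; congr (_ *: _); exact: conjc_real.
Qed.

Lemma separable_mxtrace d (sigma : 'M[C]_(d * d)) :
  separable sigma -> \tr sigma = 1.
Proof.
case=> n [p [A [B [_ p1 AB ->]]]]; rewrite raddf_sum /=.
transitivity (\sum_i (p i)%:C); last by rewrite -raddf_sum p1.
apply: eq_bigr => i _; have [[_ A1] [_ B1]] := AB i.
by rewrite mxtraceZ mxtrace_tens A1 B1 !mulr1.
Qed.

Lemma frobenius_norm_sqr n (A : 'M[C]_n) : A^t* = A ->
  ((frobenius_norm A)%:C) ^+ 2 = \tr (A *m A).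
Proof.
move=> hA; have ge0 := mxtrace_herm_sqr_ge0 hA.
rewrite /frobenius_norm hA -rmorphXn /= sqr_sqrtr ?RRe_real ?ger0_real //.
by rewrite -lecR RRe_real ?ger0_real.
Qed.

(** Ensures that the infimum defining [Dsep] is over a nonempty set. *)
Lemma separable_exists d : (0 < d)%N -> exists sigma : 'M[C]_(d * d), separable sigma.
Proof.
case: d => // d _; pose A : 'M[C]_d.+1 := delta_mx 0 0.
have hA : A^t* = A by rewrite /A trmx_delta map_delta_mx.
have stA : state A.
  split; last by rewrite /A /mxtrace (bigD1 ord0) //= big1 ?addr0 => [|i /negbTE i0];
    rewrite mxE ?eqxx ?i0.
  split=> // v; rewrite /braket.
  (* For a Hermitian idempotent, the quadratic form at [v] is the squared norm of [A *m v]. *)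
  have AA : A *m A = A by rewrite /A mul_delta_mx.
  have -> : v^t* *m (A *m v) = (A *m v)^t* *m (A *m v).
    by rewrite adjmxM hA -mulmxA [A *m (A *m v)]mulmxA AA.
  rewrite mxE sumr_ge0 // => i _.
  by rewrite !mxE mulrC mul_conjC_ge0.
exists (A *t A); exists 1%N, (fun=> 1), (fun=> A), (fun=> A).
by split; rewrite // big_ord1 ?scale1r.
Qed.

(** Coordinate [k] of the fixed-axis equation is the row sum times the nonzero constant
    [1 / sqrt d]. *)
Lemma axis_rotation_row_sum d (O : 'M[R]_d) : (0 < d)%N -> axis_rotation O ->
  forall k, \sum_l O k l = 1.
Proof.
move=> d_gt0 [_ On] k; have := congr1 (fun X : 'cV_d => X k 0) On.
rewrite !mxE; under eq_bigr => l _ do rewrite mxE.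
have n_neq0 : (Num.sqrt d%:R : R)^-1 != 0.
  by rewrite invr_eq0 sqrtr_eq0 -ltNge ltr0n.
by rewrite -mulr_suml -[RHS]mul1r => /(mulIf n_neq0).
Qed.

Lemma mub_witness_le_frobenius d L (psi : 'I_L -> 'I_d -> 'cV[C]_d)
    (O : 'I_L -> 'M[R]_d) (rho sigma : 'M[C]_(d * d)) :
  (2 <= d)%N -> (1 <= L)%N -> mutually_unbiased_bases psi ->
  (forall a, axis_rotation (O a)) -> state rho -> separable sigma ->
  - \tr (mub_witness psi O *m rho) <=
    (Num.sqrt (L%:R * (d%:R - 1)) * frobenius_norm (rho - sigma))%:C.
Proof.
move=> d_gt1 L_gt0 mubpsi rotO [[hrho _] rho1] sep.
have d_gt0 : (0 < d)%N by exact: ltnW.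
have hP := mub_projectors_rank1 mubpsi; have hQ := mub_projectors_conj hP.
set P := fun _ => _ in hP; set Q := fun _ => _ in hQ.
pose OC a : 'M[C]_d := map_mx (real_complex R) (O a).
have OCreal a : OC a \is a mxOver Num.real.
  by apply/mxOverP => k l; rewrite mxE CrealE; apply/eqP; exact: conjc_real.
have OCorth a : (OC a)^T *m OC a = 1%:M.
  by rewrite /OC map_trmx -map_mxM; case: (rotO a) => -> _; rewrite map_mx1.
have OCrow a k : \sum_l OC a k l = 1.
  under eq_bigr => l _ do rewrite mxE.
  by rewrite -raddf_sum /= (axis_rotation_row_sum d_gt0 (rotO a)).
pose B := mub_corr OC Q P.
pose c : C := (d%:R - 1 + L%:R) / d%:R.
have WE : mub_witness psi O = c *: 1%:M - B.
  rewrite /mub_witness tensmx11; congr (_ - _).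
  by do 3!(apply: eq_bigr => ? _); rewrite mxE.
have trW : - \tr (mub_witness psi O *m rho) = \tr (B *m rho) - c.
  by rewrite WE mulmxBl linearB /= -scalemxAl mul1mx mxtraceZ rho1 mulr1 opprB.
(* By convexity it is enough to treat product states, whose factors have [\tr (A *m A) <= 1]. *)
have Bsigma : \tr (B *m sigma) <= c.
  case: sep => n [p [A1 [A2 [p_ge0 p1 st ->]]]].
  rewrite mulmx_sumr raddf_sum /=.
  have -> : c = \sum_i (p i)%:C * c by rewrite -mulr_suml -raddf_sum p1 mul1r.
  apply: ler_sum => i _; rewrite -scalemxAr mxtraceZ.
  have [[[h1 psd1] t1] [[h2 psd2] t2]] := st i.
  apply: ler_wpM2l; first by rewrite ler0c.
  apply: mub_corr_prod_le => //.
    by apply: le_trans (psd_mxtrace_sqr_le h1 psd1) _; rewrite t1 expr1n.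
  by apply: le_trans (psd_mxtrace_sqr_le h2 psd2) _; rewrite t2 expr1n.
pose D := rho - sigma.
have hD : D^t* = D by rewrite adjmxB hrho (separable_herm sep).
pose B0 := B - (L%:R / d%:R) *: 1%:M.
have hB0 : B0^t* = B0.
  rewrite adjmxB adjmxZ adjmx1 (mub_corr_herm OCreal hQ hP); congr (_ - _ *: _).
  by apply/conj_Creal; rewrite rpred_div ?rpred_nat.
(* The multiple of the identity drops out because [D] has trace zero. *)
have B0D : \tr (B *m rho) - c <= \tr (B0 *m D).
  have -> : \tr (B0 *m D) = \tr (B *m rho) - \tr (B *m sigma).
    rewrite /B0 mulmxBl -scalemxAl mul1mx mulmxBr !raddfB /= !mxtraceZ.
    rewrite rho1 (separable_mxtrace sep); ring.
  by rewrite lerD2l lerN2.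
rewrite trW; apply: le_trans B0D _.
have tr_real := mxtrace_herm_mul_real hB0 hD.
apply: le_trans (real_ler_norm tr_real) _.
(* Both sides are nonnegative, so their squares can be compared by Cauchy-Schwarz. *)
rewrite -(@ler_pXn2r _ 2) ?nnegrE ?normr_ge0 ?ler0c ?mulr_ge0 ?sqrtr_ge0 //.
rewrite real_normK // rmorphM exprMn frobenius_norm_sqr //.
apply: le_trans (mxtrace_herm_CauchySchwarz hB0 hD) _.
rewrite (mxtrace_traceless_mub_corr_sqr d_gt0 OCorth OCrow hQ hP).
rewrite -rmorphXn sqr_sqrtr; last first.
  by rewrite mulr_ge0 ?ler0n // subr_ge0 ler1n.
by rewrite rmorphM rmorphB !rmorph_nat rmorph1.
Qed.

End States.

(** * Passage to the infimum over separable states *)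

Local Open Scope complex_scope.

(* The inequality is in the order of R[i], so it also asserts that
   Tr(W_L rho) is real. *)
Theorem mainTheorem4 (R : realType) (d L : nat) (hd : (2 <= d)%N)
  (hL : (1 <= L)%N) (psi : 'I_L -> 'I_d -> 'cV[R[i]]_d)
  (hpsi : mutually_unbiased_bases psi) (O : 'I_L -> 'M[R]_d)
  (hO : forall a : 'I_L, axis_rotation (O a)) (rho : 'M[R[i]]_(d * d))
  (hrho : state rho) :
  - ((Num.sqrt (L%:R * (d%:R - 1)))^-1)%:C * \tr (mub_witness psi O *m rho)
    <= (Dsep rho)%:C.
Proof.
have d_gt0 : (0 < d)%N by exact: ltnW.
have [sigma0 sep0] := @separable_exists R d d_gt0.
have bound := mub_witness_le_frobenius hd hL hpsi hO hrho.
set K := Num.sqrt _ in bound *.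
have K_gt0 : 0 < K.
  by rewrite sqrtr_gt0 mulr_gt0 ?ltr0n // subr_gt0 ltr1n.
set w := - \tr _ in bound.
(* [w] lies below a real number in the order of [R[i]], hence is real; the goal thus descends to
   [R], where the infimum lives. *)
have wE : w = (complex.Re w)%:C.
  have /RRe_real // : w \is Num.real.
  by have := ler_real (bound _ sep0) => ->; rewrite CrealE; apply/eqP/conjc_real.
rewrite mulNr -mulrN -/w wE -rmorphM lecR; apply: lb_le_inf.
  by exists (frobenius_norm (rho - sigma0)); exists sigma0.
move=> _ [sigma sep <-]; rewrite ler_pdivrMl //.
by rewrite -lecR -wE bound.
Qed.
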